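(* Let $X_1,\ldots,X_n$ be $\{0,1\}$-valued random variables with means $\mathbb{E}[X_i]=x_i$ satisfying 1-negative association. Let $f:\{0,1\}^n\to\mathbb{R}_{\ge0}$ be a non-negative monotone (non-decreasing) submodular function whose marginal values $f(S\cup\{i\})-f(S)$ all lie in $[0,1]$, and let $F$ be its multilinear extension. Let $\mu_0=F(x_1,\ldots,x_n)$. Then for every $\delta\in(0,1)$, $$\Pr[f(X_1,\ldots,X_n)\le(1-\delta)\mu_0]\le\exp(-\mu_0\delta^2/2).$$
   Context: 1-negative association: for every index $i$, every monotone function $g$ of $X_i$ alone and every monotone function $h$ of $(X_j)_{j\ne i}$, monotone in the same direction (both non-decreasing or both non-increasing), $\mathbb{E}[hg]\le\mathbb{E}[h]\mathbb{E}[g]$. Identifying $\{0,1\}^n$ with subsets of $[n]$, $f$ is submodular if $f(S\cup\{i\})-f(S)\ge f(T\cup\{i\})-f(T)$ whenever $S\subseteq T$, $i\notin T$. The multilinear extension is $F(x)=\sum_{S\subseteq[n]}f(S)\prod_{i\in S}x_i\prod_{i\notin S}(1-x_i)$ for $x\in[0,1]^n$. *)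

(* Defs.v *)
From HB Require Import structures.
From mathcomp Require Import all_boot all_order all_algebra.
From mathcomp Require Import all_classical all_reals all_analysis.

Set Implicit Arguments.
Unset Strict Implicit.
Unset Printing Implicit Defensive.

Import Order.TTheory GRing.Theory Num.Theory.

Local Open Scope ring_scope.

(* Points of {0,1}^I are compared coordinatewise; on [bool], [a ==> b] is the
   order 0 <= 1. *)
Definition cube_le (I : finType) (y z : {ffun I -> bool}) : Prop :=
  forall j, y j ==> z j.

Definition cube_nondecreasing (R : realType) (I : finType)
    (h : {ffun I -> bool} -> R) : Prop :=
  forall y z, cube_le y z -> h y <= h z.

Definition cube_nonincreasing (R : realType) (I : finType)
    (h : {ffun I -> bool} -> R) : Prop :=
  forall y z, cube_le y z -> h z <= h y.

Definition bool_nondecreasing (R : realType) (g : bool -> R) : Prop :=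
  forall a b : bool, a ==> b -> g a <= g b.

Definition bool_nonincreasing (R : realType) (g : bool -> R) : Prop :=
  forall a b : bool, a ==> b -> g b <= g a.

Definition others (n : nat) (i : 'I_n) (T : Type) (X : 'I_n -> T -> bool)
    (w : T) : {ffun {j : 'I_n | j != i} -> bool} :=
  [ffun j => X (val j) w].

Definition one_negatively_associated (d : measure_display)
    (T : measurableType d) (R : realType) (P : probability T R) (n : nat)
    (X : 'I_n -> {RV P >-> bool}) : Prop :=
  forall (i : 'I_n) (g : bool -> R)
         (h : {ffun {j : 'I_n | j != i} -> bool} -> R),
    (bool_nondecreasing g /\ cube_nondecreasing h) \/
    (bool_nonincreasing g /\ cube_nonincreasing h) ->
    ('E_P[fun w => (h (others i X w) * g (X i w))%R]
      <= 'E_P[fun w => h (others i X w)] * 'E_P[fun w => g (X i w)])%E.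

Definition set_nondecreasing (R : realType) (n : nat)
    (f : {set 'I_n} -> R) : Prop :=
  forall S T : {set 'I_n}, S \subset T -> f S <= f T.

Definition submodular (R : realType) (n : nat) (f : {set 'I_n} -> R) : Prop :=
  forall (S T : {set 'I_n}) (i : 'I_n), S \subset T -> i \notin T ->
    f (i |: T) - f T <= f (i |: S) - f S.

Definition multilinear_extension (R : realType) (n : nat)
    (f : {set 'I_n} -> R) (x : 'I_n -> R) : R :=
  \sum_(S : {set 'I_n})
    f S * (\prod_(i in S) x i) * (\prod_(i | i \notin S) (1 - x i)).

(* The subset of indices identified with the point (X_1 w, ..., X_n w). *)
Definition random_set (n : nat) (T : Type) (X : 'I_n -> T -> bool) (w : T) :
    {set 'I_n} :=
  [set i | X i w]%SET.

(* Main.v *)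
Require Import Defs.
From HB Require Import structures.
From mathcomp Require Import all_boot all_order all_algebra.
From mathcomp Require Import all_classical all_reals all_analysis.
From mathcomp Require Import ring lra.

(* Redrawing one coordinate independently does not decrease the expectation of
   a supermodular function of 1-negatively associated variables, and preserves
   supermodularity.  Since exp(- lam f) is supermodular, its expectation is at
   most the one it has for independent coordinates.

   For independent coordinates put a = 1 - exp(- lam) <= lam.  Redrawing the
   coordinates in s one at a time, induction on s gives, for all B \subset S
   with B disjoint from s,
     E[exp(- lam f(S'))] <= exp(- ((lam - a) f(B) + a E[f(S')])),
   where S' is S with the coordinates in s redrawn: by submodularity the
   marginal value of a coordinate at B dominates its expected marginal value at
   S', which pays for replacing lam by a.  Taking B empty, Chernoff's bound with
   lam = delta and exp(- delta) <= 1 - delta + delta^2 / 2 conclude. *)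

Set Implicit Arguments.
Unset Strict Implicit.
Unset Printing Implicit Defensive.

Import Order.TTheory GRing.Theory Num.Theory.

Local Open Scope ring_scope.

Section ExponentialBounds.
Variable R : realType.
Implicit Types lam d t x y : R.

Lemma series_exp_coeff_le_expR y k :
  0 <= y -> series (exp_coeff y) k <= expR y.
Proof.
move=> y0; apply: nondecreasing_cvgn_le; last exact: is_cvg_series_exp_coeff.
by apply: nondecreasing_series => m _ _; exact: exp_coeff_ge0.
Qed.

Lemma expRN_le_quadratic y : 0 <= y -> expR (- y) <= 1 - y + y ^+ 2 / 2.
Proof.
move=> y0; have q_gt0 : 0 < 1 - y + y ^+ 2 / 2.
  by have := sqr_ge0 (1 - y); lra.
rewrite expRN invf_ple ?posrE ?expR_gt0//.
apply: le_trans (series_exp_coeff_le_expR 3 y0).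
have -> : series (exp_coeff y) 3 = 1 + y + y ^+ 2 / 2.
  rewrite /series /= !big_nat_recr//= big_geq// /exp_coeff /= add0r.
  by rewrite expr0 expr1 fact0 !divr1.
rewrite -[leLHS]mul1r ler_pdivrMr//.
by have := sqr_ge0 (y ^+ 2); lra.
Qed.

Definition chord_slope lam : R := 1 - expR (- lam).

Lemma chord_slope_le lam : chord_slope lam <= lam.
Proof. by have := expR_ge1Dx (- lam); rewrite /chord_slope; lra. Qed.

Lemma expRN_le_chord lam t :
  0 <= t <= 1 -> expR (- (lam * t)) <= 1 - chord_slope lam * t.
Proof.
case/andP=> t0 t1; have := convex_expR (Itv01 t0 t1) (- lam) 0.
rewrite !convRE /= /unstable.onem mulr0 addr0 expR0 => chord.
rewrite (_ : - (lam * t) = t * - lam); last by ring.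
by apply: le_trans chord _; rewrite /chord_slope; lra.
Qed.

(* In the induction on redrawn coordinates, [d] is the marginal value at the
   fixed set and [t] the expected one. *)
Lemma expRN_two_point_le lam x t d :
  0 <= x <= 1 -> 0 <= t <= 1 -> t <= d ->
  1 - x + x * expR (- ((lam - chord_slope lam) * d + chord_slope lam * t)) <=
  expR (- (chord_slope lam * (x * t))).
Proof.
move=> /andP[x0 x1] t01 td.
have exp_le : expR (- ((lam - chord_slope lam) * d + chord_slope lam * t)) <=
    1 - chord_slope lam * t.
  apply: le_trans (expRN_le_chord lam t01).
  by rewrite ler_expR lerN2; have := chord_slope_le lam; nra.
by apply: le_trans (expR_ge1Dx _); nra.
Qed.

End ExponentialBounds.

Section SetLemmas.
Variable I : finType.
Implicit Types (i j : I) (S : {set I}).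

Lemma setU1_id i S : i \in S -> i |: S = S.
Proof. by move=> iS; apply/finset.setUidPr; rewrite finset.sub1set. Qed.

Lemma setD1_id i S : i \notin S -> S :\ i = S.
Proof.
by move=> iS; apply/finset.setDidPl; rewrite disjoint_sym disjoints1.
Qed.

Lemma setU1D1 i S : i |: (S :\ i) = i |: S.
Proof. by apply/setP => k; rewrite !inE; case: eqVneq. Qed.

Lemma setU1D1C i j S : i != j -> (i |: S) :\ j = i |: (S :\ j).
Proof.
move=> ij; apply/setP => k; rewrite !inE.
by have [->|] := eqVneq k i; rewrite ?ij.
Qed.

Lemma disjoint_setU1r i (s : seq I) S :
  [disjoint s & i |: S] = (i \notin s) && [disjoint s & S].
Proof.
rewrite disjoint_sym (@eq_disjoint _ _ (predU1 i (mem S))) => [|j].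
  by rewrite disjointU1 disjoint_sym.
by rewrite !inE.
Qed.

Lemma sum_setU1_notin (V : nmodType) i (G : {set I} -> V) :
  \sum_S G S = \sum_(S : {set I} | i \notin S) (G S + G (i |: S)).
Proof.
rewrite (bigID (fun S : {set I} => i \notin S)) /= big_split /=.
congr (_ + _).
rewrite (reindex_onto (fun S => i |: S) (fun S => S :\ i)) /=; last first.
  by move=> S; rewrite negbK => iS; rewrite finset.setD1K.
apply: eq_bigl => S; rewrite !inE eqxx /=.
by apply/eqP/idP => [<-|/finset.setU1K//]; rewrite !inE eqxx.
Qed.

End SetLemmas.

Section Marginals.
Variables (R : realType) (n : nat).
Implicit Types (f u : {set 'I_n} -> R) (S T : {set 'I_n}) (i : 'I_n).

Definition marginal u i S : R := u (i |: S) - u (S :\ i).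

Definition supermodular u := forall i, set_nondecreasing (marginal u i).

Lemma marginal_notin u i S : i \notin S -> marginal u i S = u (i |: S) - u S.
Proof. by move=> iS; rewrite /marginal setD1_id. Qed.

Lemma marginalD1 u i S : marginal u i (S :\ i) = marginal u i S.
Proof. by rewrite /marginal setU1D1 finset.setDDl finset.setUid. Qed.

Lemma set_marginalE u i S : u S = u (S :\ i) + marginal u i S * (i \in S)%:R.
Proof.
rewrite /marginal; have [iS|iS] := boolP (i \in S).
  by rewrite mulr1 subrKC setU1_id.
by rewrite mulr0 addr0 setD1_id.
Qed.

Lemma marginal_ge0 u i S : set_nondecreasing u -> 0 <= marginal u i S.
Proof.
move=> u_ndecr; rewrite subr_ge0; apply: u_ndecr.
exact: fintype.subset_trans (finset.subD1set _ _) (finset.subsetU1 _ _).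
Qed.

Lemma submodular_marginal_le f i S T :
  submodular f -> S \subset T -> marginal f i T <= marginal f i S.
Proof.
move=> f_sub ST; rewrite -(marginalD1 f i T) -(marginalD1 f i S).
rewrite !marginal_notin ?setD11//.
by apply: f_sub; [exact: finset.setSD | rewrite setD11].
Qed.

Lemma expRN_supermodular f lam :
  0 <= lam -> set_nondecreasing f -> submodular f ->
  supermodular (fun S => expR (- (lam * f S))).
Proof.
move=> lam0 f_ndecr f_sub i S T ST.
have marginalE (A : {set 'I_n}) :
    marginal (fun S => expR (- (lam * f S))) i A =
    - (expR (- (lam * f (A :\ i))) * (1 - expR (- (lam * marginal f i A)))).
  rewrite mulrBr mulr1 -expRD opprB; congr (expR _ - _).
  by rewrite /marginal; ring.
rewrite !marginalE lerN2 ler_pM ?expR_ge0//.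
- by rewrite subr_ge0 expR_le1 oppr_le0 mulr_ge0// marginal_ge0.
- by rewrite ler_expR lerN2 ler_wpM2l// f_ndecr// finset.setSD.
- by rewrite lerD2l lerN2 ler_expR lerN2 ler_wpM2l// submodular_marginal_le.
Qed.

End Marginals.

Section Resampling.
Variables (R : realType) (n : nat) (x : 'I_n -> R).
Implicit Types (f u : {set 'I_n} -> R) (S B : {set 'I_n}) (i j : 'I_n).
Implicit Types (s : seq 'I_n).

(* Expectation of [u] at [S] once the coordinate [i] has been redrawn, equal to
   1 with probability [x i]. *)
Definition resample i u S : R := (1 - x i) * u (S :\ i) + x i * u (i |: S).

Definition resample_seq s u : {set 'I_n} -> R := foldr resample u s.

Lemma resampleE i u S : resample i u S = u (S :\ i) + x i * marginal u i S.
Proof. by rewrite /resample /marginal; ring. Qed.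

Lemma eq_resample_seq s u S S' :
  (forall j, j \notin s -> (j \in S) = (j \in S')) ->
  resample_seq s u S = resample_seq s u S'.
Proof.
elim: s S S' => [|i s IH] S S' SS' /=.
  by congr u; apply/setP => j; exact: SS'.
have eq_off j : j \notin s -> j != i -> (j \in S) = (j \in S').
  by move=> js ji; apply: SS'; rewrite inE negb_or ji.
rewrite /resample (IH (S :\ i) (S' :\ i)) ?(IH (i |: S) (i |: S'))// => j js;
  by rewrite !inE; have [//|/(eq_off _ js)->] := eqVneq j i.
Qed.

Lemma marginal_resample i j u :
  i != j -> marginal (resample j u) i = resample j (marginal u i).
Proof.
move=> ij; have ji : j != i by rewrite eq_sym.
apply/funext => S; rewrite /marginal /resample.
rewrite (setU1D1C S ij) (setU1D1C S ji) (finset.setUCA [set j]%SET).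
by rewrite !finset.setDDl (finset.setUC [set i]%SET [set j]%SET); ring.
Qed.

Lemma marginal_resample_id i u S : marginal (resample i u) i S = 0.
Proof.
apply/eqP; rewrite subr_eq0; apply/eqP.
by apply: (@eq_resample_seq [:: i]) => j; rewrite !inE => /negbTE ->.
Qed.

Lemma marginal_resample_seq i s u :
  i \notin s -> marginal (resample_seq s u) i = resample_seq s (marginal u i).
Proof.
elim: s => //= j s IH; rewrite inE negb_or => /andP[ij i_s].
by rewrite marginal_resample// IH.
Qed.

Local Notation M u := (multilinear_extension u x).

Definition product_weight S : R := \prod_i (if i \in S then x i else 1 - x i).

Lemma multilinear_extensionE u : M u = \sum_S u S * product_weight S.
Proof.
apply: eq_bigr => S _; rewrite -mulrA; congr (_ * _).
rewrite /product_weight [RHS](bigID (mem S)) /=; congr (_ * _).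
  by apply: eq_bigr => i ->.
by apply: eq_bigr => i /negbTE ->.
Qed.

Lemma multilinear_extension_cst (c : R) : M (fun=> c) = c.
Proof.
rewrite multilinear_extensionE -mulr_sumr.
rewrite -(bigA_distr 1 +%R x (fun i => 1 - x i)).
by rewrite big1 ?mulr1// => i _ /=; rewrite subrKC.
Qed.

Lemma multilinear_extension_resample i u : M (resample i u) = M u.
Proof.
rewrite !multilinear_extensionE !(sum_setU1_notin i); apply: eq_bigr => S iS.
pose w := \prod_(j | j != i) (if j \in S then x j else 1 - x j).
have -> : product_weight S = (1 - x i) * w.
  by rewrite /product_weight (bigD1 i)//= (negbTE iS).
have -> : product_weight (i |: S) = x i * w.
  rewrite /product_weight (bigD1 i)//= setU11; congr (_ * _).
  by apply: eq_bigr => j /negbTE ji; rewrite !inE ji.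
rewrite /resample setD1_id// finset.setU1K// (setU1_id (setU11 _ _)); ring.
Qed.

Lemma multilinear_extension_resample_enum u S :
  M u = resample_seq (enum 'I_n) u S.
Proof.
have -> : M u = M (resample_seq (enum 'I_n) u).
  by elim: (enum _) => //= i s ->; rewrite multilinear_extension_resample.
rewrite -[RHS](multilinear_extension_cst); congr multilinear_extension.
by apply/funext => S'; apply: eq_resample_seq => j; rewrite mem_enum.
Qed.

Section Monotonicity.
Hypothesis x01 : forall i, 0 <= x i <= 1.

Lemma multilinear_extension_ge0 u : (forall S, 0 <= u S) -> 0 <= M u.
Proof.
move=> u_ge0; rewrite multilinear_extensionE sumr_ge0// => S _.
rewrite mulr_ge0// prodr_ge0// => i _.
by have := x01 i; case: ifP => _; lra.
Qed.

Lemma resample_nondecreasing i u :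
  set_nondecreasing u -> set_nondecreasing (resample i u).
Proof.
move=> u_ndecr S S' SS'; have /andP[? ?] := x01 i.
apply: lerD; apply: ler_wpM2l; rewrite ?subr_ge0//; apply: u_ndecr.
  exact: finset.setSD.
exact: finset.setUS.
Qed.

Lemma resample_seq_nondecreasing s u :
  set_nondecreasing u -> set_nondecreasing (resample_seq s u).
Proof.
by move=> u_ndecr; elim: s => //= i s; exact: resample_nondecreasing.
Qed.

Lemma resample_supermodular i u : supermodular u -> supermodular (resample i u).
Proof.
move=> u_super j; have [->|ji] := eqVneq j i.
  by move=> S S' _; rewrite !marginal_resample_id.
by rewrite marginal_resample//; exact: resample_nondecreasing.
Qed.

Lemma resample_seq_le_supset s u B (c : R) :
  [disjoint s & B] -> (forall S, B \subset S -> u S <= c) ->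
  forall S, B \subset S -> resample_seq s u S <= c.
Proof.
elim: s => [|i s IH]; first by move=> _ /(_ _ _); apply.
rewrite disjoint_cons => /andP[iB sB] u_le S BS /=.
have /andP[? ?] := x01 i.
have lower : resample_seq s u (S :\ i) <= c.
  by apply: IH => //; rewrite subsetD1 BS.
have upper : resample_seq s u (i |: S) <= c.
  by apply: IH => //; exact: fintype.subset_trans BS (finset.subsetU1 _ _).
rewrite /resample; nra.
Qed.

Lemma marginal_resample_seq_le s f i B S :
  submodular f -> i \notin s -> [disjoint s & B] -> B \subset S ->
  marginal (resample_seq s f) i S <= marginal f i B.
Proof.
move=> f_sub i_s sB BS; rewrite marginal_resample_seq//.
by apply: resample_seq_le_supset BS => // S'; exact: submodular_marginal_le.
Qed.

Section Exponential.
Variables (f : {set 'I_n} -> R) (lam : R).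
Hypotheses (f_ndecr : set_nondecreasing f) (f_sub : submodular f).
Hypothesis marginal_le1 : forall S i, f (i |: S) - f S <= 1.

Local Notation slope := (chord_slope lam).
Local Notation u := (fun S => expR (- (lam * f S))).

Lemma resample_seq_expRN_le s B S :
  uniq s -> [disjoint s & B] -> B \subset S ->
  resample_seq s u S <=
  expR (- ((lam - slope) * f B + slope * resample_seq s f S)).
Proof.
elim: s B S => [|i s IH] B S /=.
  move=> _ _ BS; rewrite ler_expR lerN2.
  by have := f_ndecr BS; have := chord_slope_le lam; nra.
move=> /andP[i_s s_uniq]; rewrite disjoint_cons => /andP[iB sB] BS.
have /andP[xi0 xi1] := x01 i.
set g := resample_seq s f; set t := marginal g i S.
set exponent : R := (lam - slope) * f B + slope * g (S :\ i).
have absent : resample_seq s u (S :\ i) <= expR (- exponent).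
  by apply: IH; rewrite // subsetD1 BS.
have present : resample_seq s u (i |: S) <=
    expR (- exponent) * expR (- ((lam - slope) * marginal f i B + slope * t)).
  have exponentE : - exponent - ((lam - slope) * marginal f i B + slope * t) =
      - ((lam - slope) * f (i |: B) + slope * g (i |: S)).
    by rewrite /exponent /t (marginal_notin f iB) /marginal; ring.
  rewrite -expRD exponentE; apply: IH; rewrite ?finset.setUS//.
  by rewrite disjoint_setU1r i_s.
have t_ge0 : 0 <= t by exact/marginal_ge0/resample_seq_nondecreasing.
have t_le : t <= marginal f i B by exact: marginal_resample_seq_le.
have t01 : 0 <= t <= 1 by rewrite t_ge0 (le_trans t_le)// marginal_notin.
have two_point := expRN_two_point_le lam (x01 i) t01 t_le.
rewrite [in leRHS]resampleE -/g -/t mulrDr addrA -/exponent opprD expRD.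
apply: le_trans (ler_wpM2l (expR_ge0 _) two_point).
rewrite /resample mulrDr; apply: lerD.
  by rewrite [leRHS]mulrC ler_wpM2l ?subr_ge0.
by rewrite mulrCA ler_wpM2l.
Qed.

Lemma multilinear_extension_expRN_le : 0 <= f finset.set0 ->
  M u <= expR (- (slope * M f)).
Proof.
move=> f0; rewrite !(multilinear_extension_resample_enum _ finset.set0).
apply: le_trans (resample_seq_expRN_le (enum_uniq _) _ (finset.sub0set _)) _.
  by rewrite disjoint_sym eq_disjoint0// => i; rewrite inE.
rewrite ler_expR lerN2 lerDr mulr_ge0// subr_ge0; exact: chord_slope_le.
Qed.

End Exponential.

End Monotonicity.

End Resampling.

Section FiniteValued.
Context (d : measure_display) (T : measurableType d) (A : finType) (W : T -> A).
Hypothesis mW : forall a, measurable (W @^-1` [set a])%classic.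

Lemma measurable_fun_finite_comp d' (U : measurableType d') (phi : A -> U) :
  measurable_fun [set: T] (phi \o W).
Proof.
move=> _ Y _; rewrite setTI.
have -> : ((phi \o W) @^-1` Y =
    \bigcup_(a in [set a | Y (phi a)]) (W @^-1` [set a]))%classic.
  apply/seteqP; split => [w YW|w [a Ya /= Wa]]; first by exists (W w).
  by rewrite /preimage /= Wa.
by apply: fin_bigcup_measurable => //; exact: finite_finset.
Qed.

Lemma Lfun1_finite_comp (R : realType) (P : probability T R) (phi : A -> R) :
  (phi \o W) \in Lfun P 1.
Proof.
apply/Lfun1_integrable/measurable_bounded_integrable => //.
- by rewrite -ge0_fin_numE// fin_num_measure.
- exact: measurable_fun_finite_comp.
exists (\sum_a `|phi a|); split; first exact: num_real.
move=> M leM w _ /=; apply: le_trans (ltW leM).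
by rewrite (bigD1 (W w))//= lerDl sumr_ge0.
Qed.

End FiniteValued.

Section RandomSet.
Context (d : measure_display) (T : measurableType d) (R : realType).
Variable P : probability T R.

Lemma boolean_mean_itv (Y : {RV P >-> bool}) (p : R) :
  'E_P[fun w => (Y w)%:R]%E = p%:E -> 0 <= p <= 1.
Proof.
have -> : (fun w => (Y w)%:R : R) = \1_(Y @^-1` [set true])%classic.
  by apply/funext => w; rewrite preimage_true indicE mem_setE.
have mY : measurable (Y @^-1` [set true])%classic by exact: measurable_funPTI.
rewrite expectation_indic// -!lee_fin => <-.
by rewrite measure_ge0 probability_le1.
Qed.

Variables (n : nat) (X : 'I_n -> {RV P >-> bool}).

Local Notation W := (random_set X).

Lemma measurable_random_set_fiber S : measurable (W @^-1` [set S])%classic.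
Proof.
have -> : (W @^-1` [set S] =
    \bigcap_(i in [set: 'I_n]) (X i @^-1` [set (i \in S)]))%classic.
  apply/seteqP; split => w /=; first by move=> <- i _ /=; rewrite inE.
  by move=> XS; apply/setP => i; rewrite inE; exact: XS.
by apply: fin_bigcap_measurable => // i _; exact: measurable_funPTI.
Qed.

Lemma Lfun1_random_set (phi : {set 'I_n} -> R) : (phi \o W) \in Lfun P 1.
Proof. exact/Lfun1_finite_comp/measurable_random_set_fiber. Qed.

Lemma nondecreasing_others_factor i (h : {set 'I_n} -> R) :
  set_nondecreasing h ->
  exists2 h' : {ffun {j : 'I_n | j != i} -> bool} -> R,
    cube_nondecreasing h' & forall w, h' (others i X w) = h (W w :\ i).
Proof.
move=> h_ndecr.
pose to_set (y : {ffun {j : 'I_n | j != i} -> bool}) : {set 'I_n} :=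
  [set j | oapp y false (insub j)]%SET.
exists (h \o to_set) => [y z yz|w /=].
  apply: h_ndecr; apply/fintype.subsetP => j; rewrite !inE.
  by case: insubP => // k _ _; apply/implyP; exact: yz.
congr h; apply/setP => j; rewrite !inE.
by case: insubP => [k ji <-|/negbTE -> //] /=; rewrite ffunE (valP k).
Qed.

Hypothesis X_neg : one_negatively_associated X.
Variable x : 'I_n -> R.
Hypothesis X_mean : forall i, 'E_P[fun w => (X i w)%:R]%E = (x i)%:E.

Let x01 i : 0 <= x i <= 1.
Proof. exact: boolean_mean_itv (X_mean i). Qed.

Lemma expectation_mem_random_set_le i (h : {set 'I_n} -> R) :
  set_nondecreasing h ->
  ('E_P[fun w => (h (W w :\ i) * (i \in W w)%:R)%R]
    <= (x i)%:E * 'E_P[fun w => h (W w :\ i)])%E.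
Proof.
move=> /(nondecreasing_others_factor i)[h' h'_ndecr h'E].
have h_offE : (fun w => h (W w :\ i)) = (fun w => h' (others i X w)).
  by apply/funext => w; rewrite h'E.
have h_memE : (fun w => (h (W w :\ i) * (i \in W w)%:R)%R) =
    (fun w => (h' (others i X w) * (X i w)%:R)%R).
  by apply/funext => w; rewrite h'E inE.
rewrite h_offE h_memE -X_mean muleC; apply: (X_neg (g := fun b => b%:R)).
by left; split=> // - [] [] //= _; exact: ler01.
Qed.

Lemma expectation_le_resample i u : supermodular u ->
  ('E_P[u \o W] <= 'E_P[resample x i u \o W])%E.
Proof.
move=> u_super; pose u_off S := u (S :\ i).
pose u_marg S := marginal u i (S :\ i).
have uE : u \o W = (u_off \o W) \+ ((fun S => u_marg S * (i \in S)%:R) \o W).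
  by apply/funext => w /=; rewrite /u_marg marginalD1 -set_marginalE.
have resampled_uE : resample x i u \o W =
    (u_off \o W) \+ (x i \o* (u_marg \o W)).
  by apply/funext => w /=; rewrite /u_marg marginalD1 resampleE mulrC.
rewrite uE resampled_uE !expectationD ?expectationZl ?Lfun_scale
  ?Lfun1_random_set//.
by rewrite leeD// expectation_mem_random_set_le.
Qed.

Lemma expectation_le_multilinear_extension u : supermodular u ->
  ('E_P[u \o W] <= (multilinear_extension u x)%:E)%E.
Proof.
move=> u_super; rewrite -(expectation_cst P).
have -> : cst (multilinear_extension u x) = resample_seq x (enum 'I_n) u \o W.
  by apply/funext => w /=; rewrite -multilinear_extension_resample_enum.
suff [] : supermodular (resample_seq x (enum 'I_n) u) /\
    ('E_P[u \o W] <= 'E_P[resample_seq x (enum 'I_n) u \o W])%E by [].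
elim: (enum _) => //= i s [super_s le_s]; split.
  exact: resample_supermodular.
exact: le_trans le_s (expectation_le_resample i super_s).
Qed.

Lemma random_set_lower_tail f lam (c : R) :
  0 < lam -> 0 <= f finset.set0 -> set_nondecreasing f -> submodular f ->
  (forall S i, f (i |: S) - f S <= 1) ->
  (P [set w | (f (W w) <= c)%R]%classic <=
    (expR (lam * c - chord_slope lam * multilinear_extension f x))%:E)%E.
Proof.
move=> lam0 f0 f_ndecr f_sub f_marginal.
pose Y : {RV P >-> R} := mfun_Sub (mem_set (measurable_fun_finite_comp
  measurable_random_set_fiber (fun S => - f S))).
have -> : [set w | (f (W w) <= c)%R]%classic = [set w | (- c <= Y w)%R]%classic.
  by apply/eq_set => w /=; rewrite lerN2.
apply: (le_trans (chernoff Y (- c) lam0)).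
rewrite mulrN opprK muleC expRD EFinM.
rewrite lee_pmul2l ?lte_fin ?expR_gt0// /mmt_gen_fun.
have -> : expR \o lam \o* Y = (fun S => expR (- (lam * f S))) \o W.
  by apply/funext => w /=; rewrite mulNr mulrC.
apply: le_trans (expectation_le_multilinear_extension _) _.
  by apply: expRN_supermodular => //; exact: ltW.
by rewrite lee_fin; apply: multilinear_extension_expRN_le => //; exact: ltW.
Qed.

End RandomSet.

Theorem theorem2 (d : measure_display) (T : measurableType d) (R : realType)
    (P : probability T R) (n : nat) (X : 'I_n -> {RV P >-> bool})
    (x : 'I_n -> R) (f : {set 'I_n} -> R) (delta : R)
    (hmean : forall i : 'I_n, 'E_P[fun w => (X i w)%:R]%E = (x i)%:E)
    (hNA : one_negatively_associated X)
    (hf0 : forall S : {set 'I_n}, 0 <= f S)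
    (hfmono : set_nondecreasing f)
    (hfsub : submodular f)
    (hfmarg : forall (S : {set 'I_n}) (i : 'I_n), 0 <= f (i |: S) - f S <= 1)
    (hdelta : 0 < delta < 1) :
  let mu0 := multilinear_extension f x in
  (P [set w | (f (random_set X w) <= (1 - delta) * mu0)%R]%classic
    <= (expR (- (mu0 * delta ^+ 2 / 2)))%:E)%E.
Proof.
cbv zeta; set mu0 := multilinear_extension f x; case/andP: hdelta => delta0 _.
have marginal_le1 S i : f (i |: S) - f S <= 1 by case/andP: (hfmarg S i).
have mu0_ge0 : 0 <= mu0.
  apply: multilinear_extension_ge0 => // i.
  exact: boolean_mean_itv (hmean i).
apply: le_trans (random_set_lower_tail hNA hmean _ delta0 (hf0 _) hfmono hfsub
  marginal_le1) _.
rewrite lee_fin ler_expR -/mu0 /chord_slope.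
by have := ler_wpM2l mu0_ge0 (expRN_le_quadratic (ltW delta0)); lra.
Qed.
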